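(* An infinite path $\langle v_0,v_1,\dotsc\rangle$ in the Farey graph $\mathscr{F}$ converges if and only if it does not return to any two distinct vertices infinitely often; that is, if and only if there do not exist two distinct vertices $u\neq v$ of $\mathscr{F}$ such that $v_n=u$ for infinitely many $n$ and $v_n=v$ for infinitely many $n$.
   Context: Let $\mathbb{R}_\infty=\mathbb{R}\cup\{\infty\}$ be the extended real line (one point at infinity, usual topology) and $\mathbb{Q}_\infty=\mathbb{Q}\cup\{\infty\}$. A reduced rational is an expression $a/b$ with $a,b$ coprime integers and $b>0$; the expression $1/0$ is also considered a reduced rational, representing $\infty$. The Farey graph $\mathscr{F}$ has vertex set $\mathbb{Q}_\infty$, and two vertices with reduced expressions $a/b$ and $c/d$ are adjacent if and only if $ad-bc=\pm1$. An infinite path in $\mathscr{F}$ is a sequence $v_0,v_1,\dotsc$ of vertices with $v_i$ adjacent to $v_{i+1}$ for all $i\geq 0$ (vertices may be repeated), denoted $\langle v_0,v_1,\dotsc\rangle$. It converges if the sequence $v_0,v_1,\dotsc$ converges in $\mathbb{R}_\infty$. *)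

(* Defs.v *)
From HB Require Import structures.
From mathcomp Require Import all_boot all_order all_algebra.
From mathcomp Require Import all_classical all_reals all_analysis.
Set Implicit Arguments.
Unset Strict Implicit.
Unset Printing Implicit Defensive.
Import Order.TTheory GRing.Theory Num.Theory.
Import numFieldNormedType.Exports.
Local Open Scope classical_set_scope.
Local Open Scope ring_scope.

(* The vertices Q u {oo} of the Farey graph; [None] is the point oo. *)
Definition farey_vertex : Type := option rat.

(* Numerator and denominator of the reduced expression a/b of a vertex:
   [numq q] and [denq q] are coprime with [0 < denq q], and oo is 1/0. *)
Definition fnum (x : farey_vertex) : int := if x is Some q then numq q else 1.
Definition fden (x : farey_vertex) : int := if x is Some q then denq q else 0.

Definition farey_adj (x y : farey_vertex) : Prop :=
  fnum x * fden y - fden x * fnum y = 1 \/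
  fnum x * fden y - fden x * fnum y = -1.

Definition farey_path (v : nat -> farey_vertex) : Prop :=
  forall i, farey_adj (v i) (v i.+1).

(* The inclusion of Q u {oo} in R u {oo}, the one-point compactification of R
   (whose point at infinity is also [None]). *)
Definition farey_real (R : realType) (x : farey_vertex) :
  one_point_compactification R := omap ratr x.

Definition farey_converges (R : realType) (v : nat -> farey_vertex) : Prop :=
  exists l : one_point_compactification R, farey_real R (v n) @[n --> \oo] --> l.

Definition infinitely_often (P : nat -> Prop) : Prop :=
  forall N : nat, exists2 n : nat, (N <= n)%N & P n.

(* Main.v *)
Require Import Defs.
From mathcomp Require Import all_boot all_order all_algebra.
From mathcomp Require Import all_classical all_reals all_analysis.
From mathcomp Require Import zify ring lra.

Set Implicit Arguments.
Unset Strict Implicit.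
Unset Printing Implicit Defensive.
Import Order.TTheory GRing.Theory Num.Theory.
Import numFieldNormedType.Exports.
Local Open Scope classical_set_scope.
Local Open Scope ring_scope.

(** Edges of the Farey graph do not cross: a path can pass from one side of an
    edge to the other only through an endpoint of that edge.  In the integer
    coordinates [(l, m)] of a vertex with respect to the two endpoints, this
    says that a step with determinant [1] or [-1] cannot go from the open
    quadrants [0 < l * m] to the open quadrants [l * m < 0]
    ([quadrant_step]).  So if neither endpoint of an edge is visited
    infinitely often, then the path eventually stays on one side of it
    ([eventually_constant_sign]).

    A convergent path has at most one vertex that recurs infinitely often,
    because such a vertex is the limit.  For the converse there are two cases.

    If some vertex [x] recurs and no other does, then in coordinates that
    send [x] to oo the neighbours of [x] are the integers.  Each integer
    is eventually avoided, and a path that avoids the integers [k] with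
    [`|k| <= K] cannot, once it has been at oo, come within distance [K]
    of the origin: it leaves oo through an integer beyond [K], and going
    further down it would have to pass through [K] or [- K].  Hence the
    path tends to [x] ([fan_eventually_close], [recurrent_vertex_close]).

    If no vertex recurs, then every edge has the path eventually on one of
    its sides.  Either the path tends to oo, or it is trapped between two
    consecutive integers ([transient_unit_interval]).  In the latter case,
    inserting mediants gives Farey intervals [a/b, c/d] with [b + d]
    arbitrarily large, each of which eventually contains the path
    ([transient_farey_interval]).  Their lengths [1 / (b * d)] tend to [0], so
    the path is a Cauchy sequence. *)

(** * Unimodular steps in the integer plane *)

Definition unimodular (l m : nat -> int) : Prop :=
  forall n, `|l n * m n.+1 - m n * l n.+1| = 1.

(** If both products were nonzero with opposite signs, then [l * m'] and
    [m * l'] would be nonzero with opposite signs, and their difference would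
    be at least [2] in absolute value. *)
Lemma quadrant_step (l m l' m' : int) :
  `|l * m' - m * l'| = 1 -> 0 < l * m -> 0 <= l' * m'.
Proof.
move=> h lm; rewrite leNgt; apply/negP => lm'.
have : (l * m') * (m * l') < 0 by nia.
have := eqr_norml (l * m' - m * l') 1.
by rewrite h eqxx => /esym/andP[/orP[]/eqP e _] hlt; nia.
Qed.

Lemma quadrant_step_lt0 (l m l' m' : int) :
  `|l * m' - m * l'| = 1 -> l * m < 0 -> l' * m' <= 0.
Proof.
move=> h lm; have := @quadrant_step (- l) m (- l') m'.
by rewrite !mulNr mulrN -opprD normrN => /(_ h); lia.
Qed.

(** A path that eventually avoids both endpoints of an edge eventually stays
    on one side of it. *)
Lemma eventually_constant_sign (l m : nat -> int) :
  unimodular l m -> (\forall n \near \oo, l n * m n != 0) ->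
  (\forall n \near \oo, 0 < l n * m n) \/ (\forall n \near \oo, l n * m n < 0).
Proof.
move=> lm1 [N _ lm0]; have := lm0 N (leqnn N).
rewrite neq_lt => /orP[] hN; [right|left].
- exists N => // n /= /subnKC <-.
  elim: (n - N)%N => [|k IH]; first by rewrite addn0.
  by rewrite addnS lt_neqAle lm0 /= ?(quadrant_step_lt0 (lm1 _)) //; lia.
- exists N => // n /= /subnKC <-.
  elim: (n - N)%N => [|k IH]; first by rewrite addn0.
  by rewrite addnS lt_neqAle eq_sym lm0 /= ?(quadrant_step (lm1 _)) //; lia.
Qed.

(** With slope [l / m], this is the statement that a path in the Farey graph
    that returns infinitely often to oo, but only finitely often to each
    integer [k], tends to oo. *)
Lemma fan_eventually_close (l m : nat -> int) :
  unimodular l m -> infinitely_often (fun n => m n = 0) ->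
  (forall k : int, \forall n \near \oo, l n != k * m n) ->
  forall K : nat, \forall n \near \oo, K%:Z * `|m n| < `|l n|.
Proof.
move=> lm1 m0 lkm K.
have [N _ hN] :
    \forall n \near \oo, forall k : int, (`|k| <= K)%N -> l n != k * m n.
  elim: K => [|K [N _ hN]].
    by apply: filterS (lkm 0) => n hn k; rewrite leqn0 absz_eq0 => /eqP->.
  near=> n => k; rewrite leq_eqVlt ltnS => /orP[/eqP kK|]; last first.
    by apply: hN; near: n; exists N.
  have [->|->] : k = K.+1%:Z \/ k = - K.+1%:Z by lia.
    by near: n; exact: lkm.
  by near: n; exact: lkm.
(* The inequality holds at a return to oo after the last visit to a
   small integer, and every later step preserves it. *)
have [n0 Nn0 mn0] := m0 N.
exists n0 => // n /= /subnKC <-; elim: (n - n0)%N => [|k IH].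
  rewrite addn0 mn0 normr0 mulr0 normr_gt0; apply/eqP => ln0.
  by have := lm1 n0; rewrite mn0 ln0 !mul0r subr0 normr0.
rewrite addnS.
have {}hN := hN (n0 + k).+1 (leq_trans Nn0 (leqW (leq_addr k n0))).
move: IH (lm1 (n0 + k)%N) hN.
set a := l _; set b := m _; set a' := l _; set b' := m _ => IH ab1 hN.
have [b0|b0] := eqVneq b 0.
  (* The neighbours of oo are the integers, here the integer [a' * b']. *)
  have b'1 : `|b'| = 1 by move: ab1; rewrite b0 mul0r subr0 normrM; nia.
  rewrite b'1 mulr1 ltNge; apply/negP => a'K.
  have /eqP[] := hN (a' * b') ltac:(rewrite abszM; lia).
  by rewrite -mulrA (_ : b' * b' = 1) ?mulr1 //; nia.
have [b'0|b'0] := eqVneq b' 0.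
  rewrite b'0 normr0 mulr0 normr_gt0; apply/eqP => a'0.
  by move: ab1; rewrite a'0 b'0; lia.
(* Away from oo, the edges from oo to [K] and to [- K] cannot be crossed. *)
have shear (c : int) : `|(a - c * b) * b' - b * (a' - c * b')| = 1.
  by rewrite -ab1; congr `| _ |; ring.
have /eqP hp := hN K%:Z ltac:(lia).
have /eqP hm := hN (- K%:Z) ltac:(lia).
have [ab|ab] : 0 < a * b \/ a * b < 0 by nia.
- have := quadrant_step (shear K%:Z); nia.
- have := quadrant_step_lt0 (shear (- K%:Z)); nia.
Unshelve. all: by end_near. Qed.

(** * Coordinates of vertices *)

(** For [0 < b] the sign of [cross a b x] tells on which side of [a/b] the
    vertex [x] lies: positive on the right, negative on the left.  When
    [b * c - a * d = 1], the integers [- cross c d x] and [cross a b x] are the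
    coordinates of [x] in the basis [(a, b), (c, d)]. *)
Definition cross (a b : int) (x : farey_vertex) : int :=
  fnum x * b - fden x * a.

Lemma fden_ge0 x : 0 <= fden x.
Proof. by case: x => [q|] //=; rewrite ltW ?denq_gt0. Qed.

Lemma fnum_fden_inj x y : fnum x * fden y = fden x * fnum y -> x = y.
Proof.
case: x y => [q|] [r|] //=; rewrite ?(mul1r, mulr1, mul0r, mulr0).
- by move=> e; congr Some; apply/eqP; rewrite rat_eq e; apply/eqP/mulrC.
- by move/esym/eqP; rewrite (negPf (denq_neq0 q)).
- by move/eqP; rewrite (negPf (denq_neq0 r)).
Qed.

Lemma cross_eq0_inj a b x y :
  (a != 0) || (b != 0) -> cross a b x = 0 -> cross a b y = 0 -> x = y.
Proof.
rewrite /cross => ab hx hy; apply: fnum_fden_inj; apply/eqP.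
rewrite -subr_eq0; set e := (X in X == 0).
have e1 : e * b = 0 by rewrite (_ : _ * _ =
   fden y * (fnum x * b - fden x * a) - fden x * (fnum y * b - fden y * a));
   [rewrite hx hy; ring | rewrite /e; ring].
have e2 : e * a = 0 by rewrite (_ : _ * _ =
   fnum y * (fnum x * b - fden x * a) - fnum x * (fnum y * b - fden y * a));
   [rewrite hx hy; ring | rewrite /e; ring].
move: e1 e2 => /eqP + /eqP; rewrite !mulf_eq0.
by case: (e == 0) => //=; case: (a == 0) (b == 0) ab => [] [].
Qed.

(** A change of basis of determinant [1] preserves determinants. *)
Lemma farey_path_unimodular v a b c d :
  farey_path v -> b * c - a * d = 1 ->
  unimodular (fun n => - cross c d (v n)) (fun n => cross a b (v n)).
Proof.
move=> hv abcd n; rewrite /cross; move: (hv n); rewrite /farey_adj.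
set D := _ - _ => hD.
rewrite (_ : _ - _ = - ((b * c - a * d) * D)); last by rewrite /D; ring.
by rewrite abcd mul1r normrN; case: hD => ->.
Qed.

Lemma not_infinitely_often P :
  ~ infinitely_often P -> \forall n \near \oo, ~ P n.
Proof.
move=> nP; apply: contrapT => h; apply: nP => N; apply: contrapT => hN.
by apply: h; exists N => // n /= Nn Pn; apply: hN; exists n.
Qed.

(** At most one vertex satisfies [cross a b x = 0], so solving this equation
    infinitely often means visiting one vertex infinitely often. *)
Lemma cross_eventually_neq0 v a b :
  (a != 0) || (b != 0) ->
  (forall x, cross a b x = 0 -> ~ infinitely_often (fun n => v n = x)) ->
  \forall n \near \oo, cross a b (v n) != 0.
Proof.
move=> ab hx.
suff : \forall n \near \oo, ~ cross a b (v n) = 0 by apply: filterS => n /eqP.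
apply: not_infinitely_often => io; have [n0 _ vn0] := io 0%N.
apply: (hx _ vn0) => N; have [n Nn vn] := io N; exists n => //.
exact: cross_eq0_inj ab vn vn0.
Qed.

(** * Criteria for convergence *)

Lemma farey_cvg_infty (R : realType) v :
  (forall K : nat, \forall n \near \oo, K%:Z * fden (v n) < `|fnum (v n)|) ->
  farey_real R (v n) @[n --> \oo] -->
    (None : one_point_compactification R).
Proof.
move=> vK A [C [cC _] CA].
have [M [_ hM]] := compact_bounded cC.
pose K := (Num.truncn (`|M| + 1)).+1.
have MK : M < K%:R.
  by have := truncnS_gt (`|M| + 1); have := ler_norm M; rewrite /K; lra.
apply: filterS (vK K) => n hn; apply: CA.
case: (v n) hn => [q|] /= hq; [left|by right].
exists (ratr q : R) => // /(hM _ MK) /=; apply/negP; rewrite -ltNge.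
rewrite -ratr_norm -[K%:R](ratr_nat R) ltr_rat.
rewrite -{1}(divq_num_den q) normf_div ltr_pdivlMr ?normr_gt0 ?intr_eq0 //.
by rewrite -!intr_norm -[K%:R]/(K%:Z%:~R) -intrM ltr_int gtr0_norm ?denq_gt0.
Qed.

Lemma cross_ratr (R : realType) (a b : int) (q : rat) : 0 < b ->
  `|ratr q - a%:~R / b%:~R| * (denq q * b)%:~R = `|cross a b (Some q)|%:~R :> R.
Proof.
move=> b0.
have q0 : 0 < (denq q * b)%:~R :> R by rewrite ltr0z mulr_gt0 ?denq_gt0.
rewrite -[X in _ * X]gtr0_norm // -normrM intr_norm; congr `| _ |.
rewrite /cross /= /ratr rmorphB !rmorphM /=; field.
by rewrite !intr_eq0 denq_neq0 gt_eqF.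
Qed.

(** By [cross_ratr], the hypothesis provides for each [K] a rational [a/b] at
    distance less than [1 / K] from every late enough term of the path, so the
    path is a Cauchy sequence. *)
Lemma farey_cvg_finite (R : realType) v :
  (forall K : nat, exists a b : int, 0 < b /\
     \forall n \near \oo, K%:Z * `|cross a b (v n)| < fden (v n) * b) ->
  farey_converges R v.
Proof.
move=> vK.
pose u n : R := if v n is Some q then ratr q else 0.
have /cauchy_cvgP : cauchy (u @ \oo).
  apply: cauchy_exP => e e0.
  pose K := (Num.truncn e^-1).+1.
  have eK : 1 < e * K%:R.
    by rewrite -ltr_pdivrMl // mulr1; exact: truncnS_gt.
  have [a [b [b0 hab]]] := vK K.
  exists (a%:~R / b%:~R).
  apply: filterS hab => n hn; rewrite /ball /= distrC /u.
  case: (v n) hn => [q|]; last by rewrite /cross /=; lia.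
  have q0 : 0 < (denq q * b)%:~R :> R by rewrite ltr0z mulr_gt0 ?denq_gt0.
  rewrite -(ltr_int R) intrM -(cross_ratr _ _ _ b0) => /= h.
  rewrite -(ltr_pM2r q0); set X := `| _ | * _ in h *.
  have X0 : 0 <= X by rewrite mulr_ge0 // ltW.
  apply: (@le_lt_trans _ _ (e * (K%:R * X))).
    by rewrite mulrA ler_peMl // ltW.
  by rewrite ltr_pM2l.
move=> cu; exists (Some (lim (u @ \oo))).
have cS : Some (u n) @[n --> \oo] -->
    (Some (lim (u @ \oo)) : one_point_compactification R).
  apply: (@continuous_cvg _ _ _ _ _ u
    (Some : R -> one_point_compactification R) _ _ cu).
  exact: one_point_compactification_some_continuous.
apply: cvg_trans cS; apply: near_eq_cvg.
(* For [K = 0] the hypothesis says that the path is eventually finite. *)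
have [a [b [b0 hab]]] := vK 0%N.
apply: filterS hab => n; rewrite /u; case: (v n) => [q|] //=.
by rewrite !mul0r ltxx.
Qed.

(** * Paths with exactly one recurrent vertex *)

(** The pair [(c, d)] completes [x] to a basis, in whose coordinates [x] is at
    infinity and the Farey neighbours of [x] are the integers. *)
Lemma recurrent_vertex_close v x c d :
  farey_path v -> fden x * c - fnum x * d = 1 ->
  infinitely_often (fun n => v n = x) ->
  (forall y, y <> x -> ~ infinitely_often (fun n => v n = y)) ->
  forall K : nat, \forall n \near \oo,
    K%:Z * `|cross (fnum x) (fden x) (v n)| < `|cross c d (v n)|.
Proof.
move=> hv xcd iox hy K.
suff : \forall n \near \oo,
    K%:Z * `|cross (fnum x) (fden x) (v n)| < `|- cross c d (v n)|.
  by apply: filterS => n; rewrite normrN.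
apply: (fan_eventually_close (farey_path_unimodular hv xcd)).
  move=> N; have [n Nn vn] := iox N; exists n => //.
  by rewrite vn /cross mulrC subrr.
move=> k.
have crossE z : cross (c + k * fnum x) (d + k * fden x) z =
   cross c d z + k * cross (fnum x) (fden x) z by rewrite /cross; ring.
have det1 : fden x * (c + k * fnum x) - fnum x * (d + k * fden x) = 1.
  by rewrite -xcd; ring.
have : \forall n \near \oo, cross (c + k * fnum x) (d + k * fden x) (v n) != 0.
  apply: cross_eventually_neq0.
    apply: contra_eqT det1; rewrite negb_or !negbK => /andP[/eqP -> /eqP ->].
    by rewrite !mulr0 subr0.
  by move=> y hyx; apply: hy => yx; move: hyx; rewrite yx /cross; lia.
by apply: filterS => n; apply: contra_neq; rewrite crossE => <-; ring.
Qed.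

Lemma recurrent_converges (R : realType) v x :
  farey_path v -> infinitely_often (fun n => v n = x) ->
  (forall y, y <> x -> ~ infinitely_often (fun n => v n = y)) ->
  farey_converges R v.
Proof.
move=> hv iox hy; have close := recurrent_vertex_close hv _ iox hy.
case: x {iox hy} close => [q|] close /=; last first.
  exists None; apply: farey_cvg_infty => K.
  have := close 0 (-1) ltac:(by []) K.
  by apply: filterS => n; rewrite /cross /=; have := fden_ge0 (v n); lia.
apply: farey_cvg_finite => K; exists (numq q), (denq q).
split; first exact: denq_gt0.
have /coprimezP[[c e] /= ce] : coprimez (denq q) (numq q).
  by rewrite coprimezE coprime_sym coprime_num_den.
pose d := - e; have dc : denq q * c - numq q * d = 1 by rewrite -ce /d; ring.
(* By [sE] below, the denominator [s] of the current vertex is at least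
   [`|l| - `|d| * `|m|]; adding [`|d|] to [K] makes up for the last term. *)
have := close c d dc (K + `|d|)%N.
apply: filterS => n; rewrite /cross /=.
set p := fnum _; set s := fden _ => h.
have s_ge0 : 0 <= s := fden_ge0 _.
have sE : s = denq q * (s * c - p * d) + d * (p * denq q - s * numq q).
  by rewrite -[LHS]mulr1 -dc; ring.
have q0 := denq_gt0 q.
set l := s * c - p * d in sE; set m := p * denq q - _ in h sE *.
have hl : (K + `|d|)%N%:Z * `|m| < `|l|.
  by rewrite -(normrN l) opprB.
have dm : `|d * m| = `|d| * `|m| by rewrite normrM.
have dl : `|l| <= `|denq q * l| by rewrite normrM ler_peMl // gtr0_norm.
apply: (@lt_le_trans _ _ s); last by rewrite ler_peMr.
move: hl dl sE s_ge0; rewrite PoszD mulrDl abszE -dm.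
by move: (K%:Z * _) (denq q * l) (d * m) => x y z; clearbody l s; lia.
Qed.

(** * Paths without recurrent vertices *)

Definition transient (v : nat -> farey_vertex) : Prop :=
  forall x, ~ infinitely_often (fun n => v n = x).

Lemma transient_cross_neq0 v a b :
  transient v -> (a != 0) || (b != 0) ->
  \forall n \near \oo, cross a b (v n) != 0.
Proof. by move=> tv ab; apply: cross_eventually_neq0 => // x _. Qed.

Lemma transient_fden_gt0 v : transient v -> \forall n \near \oo, 0 < fden (v n).
Proof.
move=> tv; have := transient_cross_neq0 (a := 1) (b := 0) tv isT.
apply: filterS => n.
by rewrite /cross lt0r fden_ge0 andbT mulr0 mulr1 sub0r oppr_eq0.
Qed.

(** The path eventually stays on one side of the edge from [k] to oo. *)
Lemma transient_integer_side v (k : int) :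
  farey_path v -> transient v ->
  (\forall n \near \oo, k * fden (v n) < fnum (v n)) \/
  (\forall n \near \oo, fnum (v n) < k * fden (v n)).
Proof.
move=> hv tv; have hden := transient_fden_gt0 tv.
have det1 : 1 * 1 - k * 0 = 1 by rewrite mulr0.
have hk : \forall n \near \oo, cross k 1 (v n) != 0.
  by apply: transient_cross_neq0 => //; rewrite orbT.
have [] := eventually_constant_sign (farey_path_unimodular hv det1).
- apply: filterS2 hden hk => n; rewrite /cross => q0 h.
  by rewrite mulf_neq0 //; lia.
- by move=> h; left; apply: filterS2 hden h => n; rewrite /cross; nia.
- by move=> h; right; apply: filterS2 hden h => n; rewrite /cross; nia.
Qed.

(** A path that does not tend to oo is eventually bounded, because it stays
    on the near side of [K] and of [- K]; then it lies between the last integer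
    that it eventually exceeds and the next one. *)
Lemma transient_unit_interval v (K : nat) :
  farey_path v -> transient v ->
  ~ (\forall n \near \oo, K%:Z * fden (v n) < `|fnum (v n)|) ->
  exists k : int, \forall n \near \oo,
    k * fden (v n) < fnum (v n) < (k + 1) * fden (v n).
Proof.
move=> hv tv hK.
have lo : \forall n \near \oo, - K%:Z * fden (v n) < fnum (v n).
  have [//|hlt] := transient_integer_side (- K%:Z) hv tv; exfalso; apply: hK.
  by apply: filterS hlt => n; lia.
have up : \forall n \near \oo, fnum (v n) < K%:Z * fden (v n).
  have [hgt|//] := transient_integer_side K%:Z hv tv; exfalso; apply: hK.
  by apply: filterS hgt => n; lia.
(* Lower the upper bound [K = - K + 2 * K] by one as long as possible. *)
have {up} : \forall n \near \oo,
    fnum (v n) < (- K%:Z + (2 * K)%N%:Z) * fden (v n).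
  by apply: filterS up => n; lia.
elim: (2 * K)%N => [|j IH] up.
  have [N _ hN] : \forall n \near \oo, False.
    by apply: filterS2 lo up => n; lia.
  by case: (hN N (leqnn N)).
have [hj|/IH//] := transient_integer_side (- K%:Z + j%:Z) hv tv.
by exists (- K%:Z + j%:Z); apply: filterS2 hj up => n /= -> /=; lia.
Qed.

(** Descent in the Stern-Brocot tree: the mediant [(a + c) / (b + d)] is joined
    by edges to [a/b] and to [c/d], and the path eventually stays in one of the
    two halves that it cuts off. *)
Lemma transient_farey_interval v (k : int) :
  farey_path v -> transient v ->
  (\forall n \near \oo, k * fden (v n) < fnum (v n) < (k + 1) * fden (v n)) ->
  forall i : nat, exists a b c d : int,
    [/\ 0 < b, 0 < d, i%:Z + 2 <= b + d, b * c - a * d = 1 &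
        \forall n \near \oo, 0 < cross a b (v n) /\ cross c d (v n) < 0].
Proof.
move=> hv tv hk; elim=> [|i [a [b [c [d [b0 d0 ibd det1 hab]]]]]].
  exists k, 1, (k + 1), 1; split => //; first by ring.
  by apply: filterS hk => n; rewrite /cross; lia.
have det1l : b * (a + c) - a * (b + d) = 1 by rewrite -det1; ring.
have det1r : (b + d) * c - (a + c) * d = 1 by rewrite -det1; ring.
have hmed : \forall n \near \oo, cross (a + c) (b + d) (v n) != 0.
  by apply: transient_cross_neq0 => //; rewrite orbC gt_eqF // addr_gt0.
have [] := eventually_constant_sign (farey_path_unimodular hv det1l).
- apply: filterS2 hab hmed => n [h1 h2] h3.
  by rewrite mulf_neq0 ?oppr_eq0 //; lia.
- move=> h; exists a, b, (a + c), (b + d); split => //; [lia..|].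
  by apply: filterS2 hab h => n [h1 h2] h3; split => //; nia.
- move=> h; exists (a + c), (b + d), c, d; split => //; [lia..|].
  by apply: filterS2 hab h => n [h1 h2] h3; split => //; nia.
Qed.

Lemma transient_converges (R : realType) v :
  farey_path v -> transient v -> farey_converges R v.
Proof.
move=> hv tv.
have [vK|/existsNP[K vK]] := pselect (forall K : nat,
    \forall n \near \oo, K%:Z * fden (v n) < `|fnum (v n)|).
  by exists None; exact: farey_cvg_infty.
have [k hk] := transient_unit_interval hv tv vK.
apply: farey_cvg_finite => i.
have [a [b [c [d [b0 d0 bd det1 h]]]]] := transient_farey_interval hv tv hk i.
exists a, b; split => //; apply: filterS h => n [].
rewrite /cross => h1 h2; rewrite gtr0_norm //.
(* The distance to [a/b] is less than the length [1 / (b * d)] of the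
   interval, and [i < b * d] because [i + 2 <= b + d]. *)
have Xd : (fnum (v n) * b - fden (v n) * a) * d < fden (v n).
  rewrite -[ltRHS]mulr1 -det1.
  have : b * (fnum (v n) * d - fden (v n) * c) < 0 by rewrite pmulr_rlt0.
  lia.
set X := _ - _ in h1 Xd *.
have bXd : b * (X * d) < b * fden (v n) by rewrite ltr_pM2l.
have ibd : i%:Z <= b * d by nia.
have : i%:Z * X <= b * d * X by rewrite ler_pM2r.
lia.
Qed.

(** * Convergence of Farey paths *)

Lemma farey_real_inj (R : realType) : injective (farey_real R).
Proof.
rewrite /farey_real => -[q|] [r|] //= [] /eqP.
by rewrite -subr_eq0 -rmorphB fmorph_eq0 subr_eq0 => /eqP ->.
Qed.

(** The compactification of the line is Hausdorff, so a value that a convergent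
    sequence takes infinitely often is its limit. *)
Lemma converges_recurrent_unique (R : realType) v x y :
  farey_converges R v -> infinitely_often (fun n => v n = x) ->
  infinitely_often (fun n => v n = y) -> x = y.
Proof.
move=> [l vl] iox ioy.
have hausd : hausdorff_space (one_point_compactification R).
  exact: one_point_compactification_hausdorff (@locally_compactR R)
    (@Rhausdorff R).
have limE z : infinitely_often (fun n => v n = z) -> farey_real R z = l.
  move=> ioz; apply: hausd => A B zA lB.
  have [N _ hN] := vl _ lB; have [n Nn vn] := ioz N.
  exists (farey_real R z); split; first exact: nbhs_singleton.
  by rewrite -vn; exact: hN.
by apply: (@farey_real_inj R); rewrite (limE x iox) (limE y ioy).
Qed.

Theorem theorem1p3 (R : realType) (v : nat -> farey_vertex)
    (hv : farey_path v) :
  farey_converges R v <->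
  ~ (exists x y : farey_vertex, x <> y /\
       infinitely_often (fun n => v n = x) /\
       infinitely_often (fun n => v n = y)).
Proof.
split.
  move=> cv [x [y [xy [iox ioy]]]].
  by apply: xy; exact: converges_recurrent_unique cv iox ioy.
move=> unique.
have [[x iox]|nrec] :=
  pselect (exists x, infinitely_often (fun n => v n = x)).
  apply: (recurrent_converges R hv iox) => y yx ioy.
  by apply: unique; exists y, x.
by apply: (transient_converges R hv) => x iox; apply: nrec; exists x.
Qed.
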